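(* Let $G$ be a finite simple graph that has at most one isolated vertex and no isolated edge (i.e., no connected component isomorphic to $K_2$). Then $\chi'_{vd}(G) \le \lfloor 5.5\,k(G)+6.5\rfloor$.
   Context: For an integer $k\ge 1$, an edge-$k$-coloring of a simple graph $G$ is an assignment of colors from $\{1,\ldots,k\}$ to the edges of $G$ such that adjacent edges (edges sharing an endvertex) receive distinct colors. For such a coloring $\varphi$ and a vertex $v$, $\varphi(v)$ denotes the set of colors on the edges incident with $v$ (the empty set if $v$ is isolated). The coloring is vertex-distinguishing if $\varphi(u)\neq\varphi(v)$ for all distinct vertices $u,v$. A graph admits a vertex-distinguishing edge-$k$-coloring for some $k$ if and only if it has at most one isolated vertex and no isolated edge; for such $G$, $\chi'_{vd}(G)$ is the least $k$ for which $G$ has a vertex-distinguishing edge-$k$-coloring. Let $\delta(G),\Delta(G)$ be the minimum and maximum degrees, and for $d\in[\delta(G),\Delta(G)]$ let $n_d$ be the number of vertices of degree $d$. Define $k(G)=\min\{k\in\mathbb{N}: \binom{k}{d}\ge n_d \text{ for all } d\in[\delta(G),\Delta(G)]\}$. *)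

(* Defs.v *)
From mathcomp Require Import all_boot all_order all_algebra.

Set Implicit Arguments.
Unset Strict Implicit.
Unset Printing Implicit Defensive.

Record sgraph := SGraph {
  vertex :> finType;
  adj : rel vertex;
  adj_sym : symmetric adj;
  adj_irr : irreflexive adj
}.

Section Graph.
Variable G : sgraph.
Implicit Types (x y : G) (A B : {set G}) (d k : nat).

Definition edges : {set {set G}} :=
  [set A | [exists x, exists y, adj x y && (A == [set x; y])]].

Definition deg x : nat := #|[set y | adj x y]|.

(* Since [deg x < #|G|], the default value of the minimum only matters for the
   graph without vertices, where both [min_deg] and [max_deg] are 0. *)
Definition min_deg : nat := \big[minn/#|G|]_x deg x.
Definition max_deg : nat := \max_x deg x.

Definition num_deg d : nat := #|[set x | deg x == d]|.

Definition isolated : {set G} := [set x | deg x == 0].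

Definition components : {set {set G}} :=
  [set [set y | connect (@adj G) x y] | x in G].

Definition induces_K2 A : bool :=
  [exists x, exists y, [&& x != y, adj x y & A == [set x; y]]].

Definition at_most_one_isolated_vertex : bool := #|isolated| <= 1.
Definition no_isolated_edge : bool := [forall A in components, ~~ induces_K2 A].

(* Colourings are represented by functions on all vertex sets; only the values
   on [edges] are ever used. *)
Definition edge_coloring k (c : {ffun {set G} -> 'I_k}) : bool :=
  [forall A in edges, forall B in edges,
     (A != B) && (A :&: B != set0) ==> (c A != c B)].

Definition palette k (c : {ffun {set G} -> 'I_k}) x : {set 'I_k} :=
  [set c A | A in edges & x \in A].

Definition vertex_distinguishing k (c : {ffun {set G} -> 'I_k}) : bool :=
  [forall x, forall y, (x != y) ==> (palette c x != palette c y)].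

Definition vd_colorable k : bool :=
  (0 < k) && [exists c : {ffun {set G} -> 'I_k},
                edge_coloring c && vertex_distinguishing c].

Definition counting_bound k : bool :=
  [forall d : 'I_max_deg.+1, (min_deg <= d) ==> (num_deg d <= 'C(k, d))].

Lemma deg0P x : reflect (forall y, ~~ adj x y) (deg x == 0).
Proof.
rewrite /deg cards_eq0; apply: (iffP eqP) => [E y|H].
  by apply/negP => xy; have := in_set0 y; rewrite -E inE xy.
by apply/setP => y; rewrite !inE (negbTE (H y)).
Qed.

Lemma edges_pair x y : adj x y -> [set x; y] \in edges.
Proof. by move=> xy; rewrite inE; apply/existsP; exists x; apply/existsP; exists y; rewrite xy /=. Qed.

Lemma vd_colorable_exists :
  at_most_one_isolated_vertex -> no_isolated_edge -> exists k, vd_colorable k.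
Proof.
move=> h0 h1; exists #|{set G}|; apply/andP; split.
  by apply/card_gt0P; exists set0.
pose c : {ffun {set G} -> 'I_#|{set G}|} := [ffun A => enum_rank A].
have c_inj A B : c A = c B -> A = B by rewrite !ffunE; apply: enum_rank_inj.
apply/existsP; exists c; apply/andP; split.
  apply/forall_inP => A _; apply/forall_inP => B _; apply/implyP => /andP[nAB _].
  by apply: contraNneq nAB => /c_inj ->.
apply/forallP => u; apply/forallP => v; apply/implyP => uv; apply/eqP => E.
have nbr a b w : palette c a = palette c b -> a != b -> adj a w -> w = b.
  move=> Eab ab aw.
  have : c [set a; w] \in palette c a.
    by apply/imsetP; exists [set a; w]; rewrite // inE edges_pair //= !inE eqxx.
  rewrite Eab => /imsetP[B]; rewrite inE => /andP[_ bB] /c_inj EB.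
  by move: bB; rewrite -EB !inE eq_sym (negbTE ab) /= => /eqP.
have vu : v != u by rewrite eq_sym.
have [uv_adj|nuv] := boolP (adj u v); last first.
  have iso a b : palette c a = palette c b -> a != b -> ~~ adj a b -> a \in isolated.
    move=> Eab ab nab; rewrite inE; apply/deg0P => w; apply/negP => aw.
    by move: nab; rewrite -(nbr a b w Eab ab aw) aw.
  have iu := iso u v E uv nuv.
  have iv : v \in isolated by apply: (iso v u) => //; rewrite adj_sym.
  have := h0; rewrite /at_most_one_isolated_vertex leqNgt => /negP; apply.
  by apply/card_gt1P; exists u, v.
have cl w : w \in [set u; v] = (w \in [set y | connect (@adj G) u y]).
  rewrite [in RHS]inE; apply/idP/idP.
    by rewrite !inE => /orP[/eqP->|/eqP->]; [apply: connect0 | apply: connect1].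
  have clo : closed (@adj G) (mem [set u; v]).
    apply: intro_closed.
      by apply: sym_connect_sym => a b; rewrite adj_sym.
    move=> a b ab; rewrite !inE => /orP[/eqP Ea|/eqP Ea]; subst a.
      by rewrite (nbr u v b E uv ab) eqxx orbT.
    by rewrite (nbr v u b _ vu ab) ?eqxx.
  by move=> /(closed_connect clo) <-; rewrite !inE eqxx.
have /forall_inP /(_ [set u; v]) := h1.
have -> : [set u; v] \in components.
  by apply/imsetP; exists u => //; apply/setP.
move=> /(_ isT) /negP; apply.
by apply/existsP; exists u; apply/existsP; exists v; rewrite uv uv_adj eqxx.
Qed.

Lemma leq_bin_self n d : 0 < d < n -> n <= 'C(n, d).
Proof.
elim: n d => [|n IHn] [|d] //=; rewrite ltnS => dn.
rewrite binS; move: dn; rewrite leq_eqVlt => /orP[/eqP <-|dn].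
  by rewrite binn binSn add1n.
by rewrite -addn1; apply: leq_add; [apply: IHn | rewrite bin_gt0 ltnW // ltnW].
Qed.

Lemma counting_bound_exists :
  at_most_one_isolated_vertex -> exists k, counting_bound k.
Proof.
move=> h0; exists (max_deg + #|G|); apply/forallP => -[d dD] /=; apply/implyP => _.
have nG : num_deg d <= #|G| by apply: max_card.
case: d dD nG => [|d] dD nG; first by rewrite bin0.
have [G0|Gpos] := posnP #|G|; first by move: nG; rewrite G0 leqn0 => /eqP ->.
apply: (leq_trans nG); apply: leq_trans (leq_addl max_deg #|G|) (leq_bin_self _).
by rewrite /=; apply: leq_trans dD _; rewrite -addn1 leq_add2l.
Qed.

Definition chi_vd (h0 : at_most_one_isolated_vertex) (h1 : no_isolated_edge) : nat :=
  ex_minn (vd_colorable_exists h0 h1).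

Definition kG (h0 : at_most_one_isolated_vertex) : nat :=
  ex_minn (counting_bound_exists h0).

End Graph.

(* Main.v *)
Require Import Defs.
From mathcomp Require Import all_boot all_order all_algebra.
From mathcomp Require Import zify lra.

(** Rosenfeld's counting method.  With [k = kG], [M = 5k + 4] colours and
    [N(X)] the number of colourings that are proper on the edge set [X] and
    distinguish all vertices whose edges all lie in [X], one shows by induction
    that [2k * N(X - e) <= M * N(X)] for every edge [e = uv] of [X], so that
    [N(edges G) > 0].  Colourings range over all vertex sets, so the values
    outside [X] are free and ratios of counts behave like probabilities.

    Among the colourings good on [X - e], a fraction at most
    [((deg u - 1) + (deg v - 1)) / M] is improper at [e].  If [u] gets the palette
    of a vertex [w] of the same degree [d], then the other edges determine the
    colours at the edges of [u] not at [w] up to order.  By induction, deleting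
    one of these edges multiplies [N] by at most [M / 2k], so a non-neighbour [w]
    costs a fraction at most [d! / (M (2k)^(d-1))].
    There are at most ['C(k, d)] such [w] and ['C(k, d) * d! = k ^_ d], hence their
    total cost is at most [k / M] if [d = 1] and [(k-1) / 2M] if [d >= 2].
    The neighbours of [u] only add a constant over [M]. *)

Set Implicit Arguments.
Unset Strict Implicit.
Unset Printing Implicit Defensive.

(** * Counting colourings through free coordinates *)

Section IndependentCoordinates.
Variables (T : finType) (M : nat).
Local Notation fT := {ffun T -> 'I_M}.
Implicit Types (Q : pred fT) (c : fT) (e : T) (s : seq T).

Definition upd c e (a : 'I_M) : fT := [ffun x => if x == e then a else c x].

(** Neither [Q] nor [B] sees the colour of [e], so that colour is uniform given the rest. Formally,
    exchanging [c e] with an independent colour [a] is an involution on pairs [(c, a)], and it turns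
    the condition [c e \in B c] into [a \in B c]. *)
Lemma count_coord Q e (B : fT -> {set 'I_M}) b :
  (forall c a, Q (upd c e a) = Q c) -> (forall c a, B (upd c e a) = B c) ->
  (forall c, Q c -> #|B c| <= b) ->
  #|[set c | Q c & c e \in B c]| * M <= b * #|[set c | Q c]|.
Proof.
move=> hQ hB hb.
pose h (p : fT * 'I_M) := (upd p.1 e p.2, p.1 e).
have hK : involutive h.
  case=> c a; rewrite /h /= ffunE eqxx; congr pair.
  by apply/ffunP => x; rewrite !ffunE; case: eqP => // ->.
rewrite -[X in _ * X]card_ord -cardsT -cardsX -(card_imset _ (inv_inj hK)).
apply: (@leq_trans (\sum_(c | Q c) #|B c|)); last first.
  by rewrite mulnC -sum_nat_const [leqRHS](eq_bigl Q) ?leq_sum // => c; rewrite inE.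
have -> : \sum_(c | Q c) #|B c| = #|[set p : fT * 'I_M | Q p.1 & p.2 \in B p.1]|.
  rewrite -sum1dep_card (eq_bigl (fun p : fT * 'I_M => Q p.1 && (p.2 \in B p.1))) //.
  rewrite -(pair_big_dep Q (fun c a => a \in B c) (fun _ _ => 1)) /=.
  by apply: eq_bigr => c _; rewrite sum1_card.
apply/subset_leq_card/subsetP => _ /imsetP[[c a] + ->].
by rewrite !inE /= hQ hB andbT.
Qed.

(** The positions of [s] are coloured one at a time: each new colour must lie in [P c] and avoid the
    colours already used on [s], and these successive choices build up the falling factorial. *)
Lemma count_inj_into Q (P : fT -> {set 'I_M}) m s :
  uniq s ->
  (forall c c', {in predC (mem s), c =1 c'} -> Q c = Q c') ->
  (forall c c', {in predC (mem s), c =1 c'} -> P c = P c') ->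
  (forall c, #|P c| <= m) ->
  #|[set c | [&& Q c, uniq (map c s) & all (fun x => c x \in P c) s]]| * M ^ size s
    <= m ^_ (size s) * #|[set c | Q c]|.
Proof.
elim: s => [_ _ _ _|e s IHs /= /andP[es us] hQ hP hm].
  by rewrite expn0 ffactn0 mul1n muln1 subset_leq_card //; apply/subsetP => c; rewrite !inE => /and3P[].
have weak c c' : {in predC (mem s), c =1 c'} -> {in predC (mem (e :: s)), c =1 c'}.
  by move=> H x; rewrite !inE negb_or => /andP[_ xs]; apply: H.
have {}IHs := IHs us (fun c c' H => hQ c c' (weak c c' H)) (fun c c' H => hP c c' (weak c c' H)) hm.
pose Q' : pred fT := fun c => [&& Q c, uniq (map c s) & all (fun x => c x \in P c) s].
have uQ c a : Q (upd c e a) = Q c.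
  by apply: hQ => x; rewrite !inE negb_or ffunE => /andP[/negbTE-> _].
have uP c a : P (upd c e a) = P c.
  by apply: hP => x; rewrite !inE negb_or ffunE => /andP[/negbTE-> _].
have us' c a : {in s, upd c e a =1 c}.
  by move=> x xs; rewrite ffunE; case: eqP => // xe; rewrite -xe xs in es.
have um c a : map (upd c e a) s = map c s by apply/eq_in_map/us'.
have uQ' c a : Q' (upd c e a) = Q' c.
  rewrite /Q' uQ um uP; congr [&& _, _ & _].
  by apply: eq_in_all => x xs; rewrite us'.
have uB c a : P (upd c e a) :\: [set y in map (upd c e a) s] = P c :\: [set y in map c s].
  by rewrite uP um.
have cB c : Q' c -> #|P c :\: [set y in map c s]| <= m - size s.
  move=> /and3P[_ uc ac]; rewrite cardsD.
  have -> : P c :&: [set y in map c s] = [set y in map c s].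
    apply/setIidPr/subsetP => y; rewrite inE => /mapP[x xs ->].
    exact: (allP ac).
  by rewrite cardsE (card_uniqP uc) size_map leq_sub2r.
have H := count_coord uQ' uB cB; rewrite expnS ffactnSr mulnA.
apply: (@leq_trans (#|[set c | Q' c & c e \in P c :\: [set y in map c s]]| * M * M ^ size s)).
  rewrite !leq_mul2r; apply/orP; right; apply/orP; right.
  apply/subset_leq_card/subsetP => c; rewrite !inE /Q'.
  by case/and3P=> -> /andP[-> ->] /andP[-> ->].
apply: (leq_trans (leq_mul H (leqnn _))).
by rewrite -mulnA -[leqRHS]mulnA [leqRHS]mulnCA leq_mul2l IHs orbT.
Qed.

End IndependentCoordinates.

(** * Numerical estimates *)

Lemma leq_card_bigcup (I T : finType) (P : pred I) (F : I -> {set T}) :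
  #|\bigcup_(i | P i) F i| <= \sum_(i | P i) #|F i|.
Proof.
elim/big_rec2: _ => [|i n A _ h]; first by rewrite cards0.
by apply: leq_trans (leq_card_setU _ _) _; rewrite leq_add2l.
Qed.

Lemma leq_exp2rW m n e : m <= n -> m ^ e <= n ^ e.
Proof. by case: e => // e; rewrite leq_exp2r. Qed.

Lemma leq_ffact_exp n m : n ^_ m <= n ^ m.
Proof. by elim: m => // m IHm; rewrite ffactnSr expnSr leq_mul // leq_subr. Qed.

(** Yields the cost of the non-neighbours in degree at least 2. The factors [k * k.-1] are kept, and
    each later one is bounded by [2 * k]. *)
Lemma leq_double_ffact k d : 1 < d -> 2 * k ^_ d <= k.-1 * (2 * k) ^ d.-1.
Proof.
case: d => [|[|d]] // _ /=; rewrite !ffactnS expnS expnMn.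
have h : k.-2 ^_ d <= 2 ^ d * k ^ d.
  apply: leq_trans (leq_ffact_exp _ _) _; rewrite -expnMn leq_exp2rW //; lia.
by rewrite (_ : 2 * (k * (k.-1 * k.-2 ^_ d)) = k.-1 * (2 * k * k.-2 ^_ d)) ?leq_mul //; lia.
Qed.

(** Bounds the joint cost of the [d.+1] neighbours other than [v] of a vertex of degree [d.+2]. It
    combines [d.+1 <= 2 ^ d] with [(d.+1)! = d.+1 ^_ d <= k ^ d]. *)
Lemma leq_fact_exp k d : d.+1 < k -> d.+1 * (d.+1)`! <= (2 * k) ^ d.
Proof.
move=> dk; rewrite expnMn; apply: leq_mul; first exact: ltn_expl.
rewrite -ffactnn ffactnSr subSnn muln1.
apply: leq_trans (leq_ffact_exp _ _) _; apply: leq_exp2rW; exact: ltnW.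
Qed.

(** Union bound over the four ways an added edge can fail: improper, a clash at either end, a clash
    between the two ends. The factor 2 clears the halves in the costs. *)
Lemma weighted_union_bound p q r n0 n1 n2 n3 n4 n m :
  n0 <= n1 + n2 + (n3 + n4) -> n1 * m <= p * n ->
  2 * (m * n2) <= q * n -> 2 * (m * n3) <= r * n -> m * n4 <= 5 * n ->
  2 * (m * n0) <= (2 * p + q + r + 10) * n.
Proof.
move=> h; have : m * n0 <= m * (n1 + n2 + (n3 + n4)) by rewrite leq_mul2l h orbT.
lia.
Qed.

(** * Partial good colourings and clashing palettes *)

Section Incidence.
Variable G : sgraph.
Implicit Types (x y u v w : G) (A B : {set G}) (X Y Z S : {set {set G}}).

Definition inc x : {set {set G}} := [set A in edges G | x \in A].

Lemma edgesP A :
  reflect (exists x y, adj x y /\ A = [set x; y]) (A \in edges G).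
Proof.
rewrite inE; apply: (iffP existsP) => [[x /existsP[y /andP[xy /eqP->]]]|[x [y [xy ->]]]].
  by exists x, y.
by exists x; apply/existsP; exists y; rewrite xy /=.
Qed.

Lemma adj_neq x y : adj x y -> x != y.
Proof. by apply: contraTneq => ->; rewrite adj_irr. Qed.

Lemma incP x A : reflect (exists2 y, adj x y & A = [set x; y]) (A \in inc x).
Proof.
rewrite inE; apply: (iffP andP) => [[/edgesP[a [b [ab ->]]]]|[y xy ->]].
  rewrite !inE => /orP[] /eqP ->; first by exists b.
  by exists a; rewrite 1?adj_sym // setUC.
by rewrite edges_pair // !inE eqxx.
Qed.

Lemma inc_pairl x y : adj x y -> [set x; y] \in inc x.
Proof. by move=> xy; apply/incP; exists y. Qed.

Lemma inc_pairr x y : adj x y -> [set x; y] \in inc y.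
Proof. by move=> xy; rewrite setUC inc_pairl // adj_sym. Qed.

Lemma mem_inc x A : (A \in inc x) = (A \in edges G) && (x \in A).
Proof. by rewrite [LHS]inE. Qed.

Lemma card_inc x : #|inc x| = deg x.
Proof.
have -> : inc x = [set [set x; y] | y in [set y | adj x y]].
  apply/setP => A; apply/incP/imsetP => [[y xy ->]|[y]].
    by exists y; rewrite ?inE.
  by rewrite inE => xy ->; exists y.
rewrite card_in_imset // => y z; rewrite !inE => xy _ E.
have : y \in [set x; z] by rewrite -E !inE eqxx orbT.
by rewrite !inE eq_sym (negbTE (adj_neq xy)) => /eqP.
Qed.

Lemma incI x y : x != y ->
  inc x :&: inc y = if adj x y then [set [set x; y]] else set0.
Proof.
move=> xy; apply/setP => A; apply/setIP/idP => [[/incP[z xz ->]]|].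
  rewrite mem_inc !in_set2 (eq_sym y) (negbTE xy) => /andP[_ /eqP ->].
  by rewrite xz inE.
by case: ifP => a; rewrite inE => // /eqP ->; rewrite inc_pairl ?inc_pairr.
Qed.

Lemma card_incD x y : x != y -> #|inc x :\: inc y| = deg x - adj x y.
Proof.
by move=> xy; rewrite cardsD incI // card_inc; case: ifP; rewrite ?cards1 ?cards0.
Qed.

Variable M : nat.
Implicit Types c : {ffun {set G} -> 'I_M}.

Definition proper_on X c :=
  [forall A in X, forall B in X, (A != B) && (A :&: B != set0) ==> (c A != c B)].

(* A vertex is only required to be distinguished once all its edges are in [X]. *)
Definition good X c :=
  proper_on X c &&
  [forall x, forall y, [&& x != y, inc x \subset X & inc y \subset X] ==>
     (c @: inc x != c @: inc y)].

Definition num_good X := #|[set c | good X c]|.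

Lemma proper_onP X c :
  reflect {in X &, forall A B, A != B -> A :&: B != set0 -> c A != c B}
          (proper_on X c).
Proof.
apply: (iffP forall_inP) => [h A B AX BX AB I|h A AX].
  by have /forall_inP/(_ B BX)/implyP := h A AX; rewrite AB I => ->.
by apply/forall_inP => B BX; apply/implyP => /andP[]; apply: h.
Qed.

Lemma goodP X c :
  reflect (proper_on X c /\ forall x y, x != y -> inc x \subset X ->
             inc y \subset X -> c @: inc x != c @: inc y) (good X c).
Proof.
apply: (iffP andP) => -[p h]; split=> //.
  move=> x y xy xX yX; move/forallP/(_ x)/forallP/(_ y)/implyP: h.
  by rewrite xy xX yX => ->.
by apply/forallP => x; apply/forallP => y; apply/implyP => /and3P[]; apply: h.
Qed.

Lemma good_sub X Y c : Y \subset X -> good X c -> good Y c.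
Proof.
move=> YX /goodP[/proper_onP p h]; apply/goodP; split.
  by apply/proper_onP => A B AY BY; apply: p; apply: (subsetP YX).
by move=> x y xy xY yY; apply: h => //; apply: subset_trans YX.
Qed.

Lemma good_agree X c c' : {in X, c =1 c'} -> good X c = good X c'.
Proof.
wlog suff imp : c c' / {in X, c =1 c'} -> good X c -> good X c'.
  by move=> cc'; apply/idP/idP; apply: imp => // A AX; rewrite cc'.
move=> cc' /goodP[/proper_onP p h]; apply/goodP; split.
  by apply/proper_onP => A B AX BX; rewrite -!cc' //; apply: p.
move=> x y xy xX yX; have := h x y xy xX yX.
rewrite (eq_in_imset (g := c')) ?[c @: inc y](eq_in_imset (g := c')) // => A.
  by move/(subsetP yX)/cc'.
by move/(subsetP xX)/cc'.
Qed.

Lemma proper_on_inj X c x : proper_on X c -> inc x \subset X -> {in inc x &, injective c}.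
Proof.
move=> /proper_onP p xX A B Ax Bx E; apply/eqP; apply: contraT => AB.
have := p A B (subsetP xX _ Ax) (subsetP xX _ Bx) AB; rewrite E eqxx; apply.
apply/set0Pn; exists x; rewrite inE.
by move: Ax Bx; rewrite !mem_inc => /andP[_ ->] /andP[_ ->].
Qed.

(** Quantifying over all subsets of [Z] lets several edges be deleted in succession. *)
Definition growth b Z :=
  forall X e, X \subset Z -> e \in X -> b * num_good (X :\ e) <= M * num_good X.

Lemma growth_exp b Z S : growth b Z -> S \subset Z ->
  b ^ #|S| * num_good (Z :\: S) <= M ^ #|S| * num_good Z.
Proof.
move=> gZ; move: {2}#|S| (erefl #|S|) => n; elim: n S => [|n IHn] S nS SZ.
  by rewrite nS (cards0_eq nS) setD0.
have /card_gt0P[e eS] : 0 < #|S| by rewrite nS.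
have nS' : #|S :\ e| = n by move: nS; rewrite (cardsD1 e) eS => -[].
have ZE : Z :\: S = (Z :\: (S :\ e)) :\ e.
  by apply/setP => A; rewrite !inE; case: eqP => //= ->; rewrite eS.
have eZ : e \in Z :\: (S :\ e) by rewrite !inE eqxx (subsetP SZ).
have := IHn _ nS' (subset_trans (subD1set _ _) SZ); rewrite nS nS' => h.
have := gZ _ _ (subsetDl _ _) eZ; rewrite -ZE => h1.
rewrite !expnS -!mulnA.
apply: (@leq_trans (b ^ n * (M * num_good (Z :\: (S :\ e))))).
  by rewrite mulnCA leq_mul2l h1 orbT.
by rewrite mulnCA leq_mul2l h orbT.
Qed.

(** The palettes are those of the full stars, while goodness concerns [Z] only, which may lack an
    edge at [x]; hence injectivity on [inc x] is demanded separately, as a cardinality. *)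
Definition clash Z x y : {set {ffun {set G} -> 'I_M}} :=
  [set c | [&& good Z c, #|c @: inc x| == #|inc x| & c @: inc x == c @: inc y]].

(** In a clash the edges of [s] carry distinct colours from the palette of [inc y :\: inc x], which
    by equality of degrees has at most [#|s|] colours. This leaves at most [#|s|!] colourings of [s]
    for each colouring of the rest; [growth_exp] then compares [Z :\: s] with [Z]. *)
Lemma clash_bound b Z x y s :
  0 < M -> growth b Z -> x != y -> deg x = deg y -> s = inc x :\: inc y ->
  #|clash Z x y| * M ^ (#|s| - #|s :&: Z|) * b ^ #|s :&: Z| <= #|s|`! * num_good Z.
Proof.
move=> M0 gZ xy dxy sE; have := growth_exp gZ (subsetIr s Z).
have -> : Z :\: (s :&: Z) = Z :\: s.
  by apply/setP => A; rewrite !in_setD in_setI; case: (A \in Z); rewrite ?andbT ?andbF.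
set a := #|s :&: Z| => hg.
have as_ : a <= #|s| by rewrite subset_leq_card // subsetIl.
have cs : #|inc y :\: inc x| = #|s| by rewrite sE !card_incD // 1?eq_sym // adj_sym dxy.
have hc : #|clash Z x y| * M ^ #|s| <= #|s|`! * num_good (Z :\: s).
  have := @count_inj_into _ M (good (Z :\: s)) (fun c => c @: (inc y :\: inc x)) #|s| (enum s).
  rewrite -cardE ffactnn => /(_ (enum_uniq _) _ _ _) h.
  apply: leq_trans (h _ _ _).
  - rewrite leq_mul2r; apply/orP; right; apply/subset_leq_card/subsetP => c.
    rewrite !inE sE => /and3P[gc /imset_injP cx /eqP cxy]; apply/and3P; split.
    + exact: good_sub (subsetDl _ _) gc.
    + rewrite map_inj_in_uniq ?enum_uniq // => A B; rewrite !mem_enum.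
      by move=> /setDP[Ax _] /setDP[Bx _]; apply: cx.
    + apply/allP => A; rewrite mem_enum => /setDP[Ax nAy].
      (* The colour of [A] recurs on an edge [B] at [y]. If [B] also met [x], injectivity at [x]
         would give [A = B], although [A] avoids [y]. *)
      have /imsetP[B By cAB] : c A \in c @: inc y by rewrite -cxy imset_f.
      rewrite cAB imset_f // inE By andbT; apply/negP => Bx.
      by move: nAy; rewrite (cx _ _ Ax Bx cAB) By.
  - move=> c c' cc'; apply: good_agree => A /setDP[_ As].
    by apply: cc'; rewrite !inE mem_enum.
  - move=> c c' cc'; apply: eq_in_imset => A /setDP[_ Ax].
    by apply: cc'; rewrite !inE mem_enum sE; apply: contra Ax => /setDP[].
  - by move=> c; apply: leq_trans (leq_imset_card _ _) _; rewrite cs.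
rewrite -(@leq_pmul2l (M ^ a)) ?expn_gt0 ?M0 //.
rewrite -{1}(subnKC as_) expnD in hc.
apply: (@leq_trans (#|s|`! * (b ^ a * num_good (Z :\: s)))).
  rewrite mulnA [leqRHS]mulnCA [leqRHS]mulnC leq_mul2r mulnCA.
  by apply/orP; right.
by rewrite [leqRHS]mulnCA leq_mul2l hg orbT.
Qed.

End Incidence.

(** * The cost of adding one edge *)

Section Growth.
Variables (G : sgraph) (k : nat).
(* [b] is the growth factor: each further edge multiplies [num_good] by at least [b / M]. *)
Let M := 5 * k + 4.
Let b := 2 * k.
Hypothesis num_deg_bin : forall x : G, num_deg G (deg x) <= 'C(k, deg x).
Implicit Types (x y u v w : G) (X Z : {set {set G}}).
Local Notation num_good := (@num_good G M).
Local Notation clash := (@clash G M).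

(** The vertex [x] itself is counted by [num_deg], so the binomial coefficient is positive. *)
Lemma deg_le_bound x : deg x <= k.
Proof.
have : 0 < 'C(k, deg x) by apply: leq_trans (num_deg_bin x); apply/card_gt0P; exists x; rewrite inE.
by rewrite bin_gt0.
Qed.

Lemma M_gt0 : 0 < M.
Proof. by rewrite /M addn4. Qed.

(** As [w] is not an end of [uv], this edge lies in [inc u :\: inc w], and it is the only such edge
    outside [X :\ [set u; v]]. It contributes the single factor [M]; every other edge contributes a
    factor [b]. *)
Lemma card_clash u v w X :
  inc u \subset X -> adj u v -> w != u -> w != v -> deg w = deg u ->
  growth M b (X :\ [set u; v]) ->
  #|clash (X :\ [set u; v]) u w| * M * b ^ (deg u - adj u w).-1
    <= (deg u - adj u w)`! * num_good (X :\ [set u; v]).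
Proof.
move=> uX uv wu wv dw gr; rewrite eq_sym in wu.
have := clash_bound M_gt0 gr wu (esym dw) erefl.
set s := inc u :\: inc w; have cs : #|s| = deg u - adj u w by rewrite card_incD.
have es : [set u; v] \in s.
  rewrite in_setD inc_pairl // andbT mem_inc !in_set2 negb_and negb_or.
  by rewrite eq_sym wu wv orbT.
have -> : s :&: (X :\ [set u; v]) = s :\ [set u; v].
  apply/setP => A; rewrite in_setI !in_setD1 andbCA.
  case: (boolP (A \in s)) => [/setDP[Au _]|_]; last by rewrite !andbF.
  by rewrite (subsetP uX) // andbT.
have -> : #|s :\ [set u; v]| = #|s|.-1 by rewrite (cardsD1 [set u; v] s) es.
rewrite cs (_ : _ - _ = 1) ?expn1 //.
by have : 0 < #|s| by [apply/card_gt0P; exists [set u; v]]; rewrite cs; lia.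
Qed.

(** Here [uv] belongs to both stars, so its free colour gains nothing and no factor [M] arises.
    Instead one factor [b] is left over after [leq_fact_exp], and [M <= 5 * b] because [k] is
    positive. *)
Lemma card_clash_ends u v X :
  inc u \subset X -> adj u v -> deg u = deg v -> 1 < deg u ->
  growth M b (X :\ [set u; v]) ->
  M * #|clash (X :\ [set u; v]) u v| <= 5 * num_good (X :\ [set u; v]).
Proof.
move=> uX uv duv du gr.
have := clash_bound M_gt0 gr (adj_neq uv) duv erefl.
set s := inc u :\: inc v; have cs : #|s| = (deg u).-1.
  by rewrite card_incD ?adj_neq // uv subn1.
have /setIidPl-> : s \subset X :\ [set u; v].
  apply/subsetP => A /setDP[Au nAv]; rewrite in_setD1 (subsetP uX) // andbT.
  by apply: contraNneq nAv => ->; apply: inc_pairr.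
rewrite subnn muln1 cs; move: du (deg_le_bound u).
case: (deg u) => [|[|d]] // _ dk /=; rewrite expnS.
have := leq_fact_exp dk; rewrite -/b.
set N := num_good _; set Y := #|_| => h1 h2.
have bd : 0 < b ^ d by rewrite expn_gt0 /b; lia.
have h3 : Y * b <= N.
  rewrite -(leq_pmul2r bd) -mulnA (leq_trans h2) // mulnC leq_mul2l.
  by apply/orP; right; apply: leq_trans h1; rewrite leq_pmull.
apply: (@leq_trans (5 * (Y * b))); last by rewrite leq_mul2l h3.
by rewrite mulnC mulnCA leq_mul2l /M /b; apply/orP; right; lia.
Qed.

Definition clashes Z u v :=
  \bigcup_(w | [&& w != u, w != v & deg w == deg u]) clash Z u w.

(** For degree at least 2, [k.+1] is [k.-1] from the non-neighbours plus 2 from the neighbours. For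
    degree 1 the only neighbour is [v], which [clashes] excludes, and at most [k] non-neighbours
    remain. *)
Lemma card_clashes u v X :
  inc u \subset X -> adj u v -> growth M b (X :\ [set u; v]) ->
  2 * (M * #|clashes (X :\ [set u; v]) u v|)
    <= (if deg u == 1 then 2 * k else k.+1) * num_good (X :\ [set u; v]).
Proof.
move=> uX uv gr; have cc w := @card_clash u v w X uX uv.
rewrite /clashes; move: cc; set N := num_good _; set Z := X :\ _ => cc.
have du : 0 < deg u by apply/card_gt0P; exists v; rewrite inE.
have dk := deg_le_bound u.
pose nadj := \sum_(w | [&& w != u, w != v & deg w == deg u] && ~~ adj u w) #|clash Z u w|.
pose yadj := \sum_(w | [&& w != u, w != v & deg w == deg u] && adj u w) #|clash Z u w|.
have hU : #|clashes Z u v| <= yadj + nadj.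
  by rewrite /nadj /yadj -bigID; apply: leq_card_bigcup.
have hn : nadj * (M * b ^ (deg u).-1) <= k ^_ (deg u) * N.
  rewrite -bin_ffact big_distrl /=.
  apply: (@leq_trans (\sum_(w | deg w == deg u) (deg u)`! * N)); last first.
    rewrite sum_nat_const -mulnA leq_mul2r; apply/orP; right.
    by apply: leq_trans (num_deg_bin u); rewrite /num_deg cardsE.
  rewrite big_mkcond [leqRHS]big_mkcond; apply: leq_sum => w _.
  case: ifP => // /andP[/and3P[wu wv /eqP dw] nuw]; rewrite dw eqxx.
  by have := cc w wu wv dw gr; rewrite (negbTE nuw) subn0 mulnA.
(* A neighbour [w] shares the edge [uw] with [u], which loses one factor [b]; but only [deg u - 1]
   neighbours differ from [v]. *)
have hy : yadj * (M * b ^ (deg u).-2) <= (deg u).-1 * ((deg u).-1)`! * N.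
  rewrite big_distrl /=.
  apply: (@leq_trans (\sum_(w in [set y | adj u y] :\ v) ((deg u).-1)`! * N)); last first.
    rewrite sum_nat_const -mulnA leq_mul2r; apply/orP; right.
    by rewrite /deg [X in _ <= X.-1](cardsD1 v) inE uv.
  rewrite big_mkcond [leqRHS]big_mkcond; apply: leq_sum => w _.
  case: ifP => // /andP[/and3P[wu wv /eqP dw] uw]; rewrite !inE wv uw.
  by have := cc w wu wv dw gr; rewrite uw subn1 mulnA.
have b0 n : 0 < b ^ n by rewrite expn_gt0 /b; lia.
apply: (@leq_trans (2 * (M * (yadj + nadj)))); first by rewrite !leq_mul2l hU !orbT.
case: (deg u) du dk hn hy => [|[|d]] // _ dk hn hy /=.
  move: hn hy; rewrite /= expn0 ffactn1; lia.
have {}hy : M * yadj <= N.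
  rewrite -(leq_pmul2r (b0 d)) [M * yadj]mulnC -mulnA (leq_trans hy) //.
  by rewrite mulnC leq_mul2l (leq_fact_exp dk) orbT.
have {}hn : 2 * (M * nadj) <= k.-1 * N.
  rewrite -(leq_pmul2r (b0 d.+1)).
  apply: (@leq_trans (2 * k ^_ d.+2 * N)); first by rewrite /= in hn; lia.
  by rewrite [leqRHS]mulnAC leq_mul2r (leq_double_ffact k (isT : 1 < d.+2)) orbT.
nia.
Qed.

(** If [c] is proper on [X], its failure is a pair of vertices with equal palettes, hence of equal
    degree. One of them is an end of [uv], since otherwise both stars lie in [Z], where [c] is
    good. *)
Lemma bad_cover u v X c :
  X \subset edges G -> adj u v -> [set u; v] \in X ->
  let Z := X :\ [set u; v] in
  good Z c -> ~~ good X c ->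
  [|| c [set u; v] \in c @: ((inc u :|: inc v) :\ [set u; v]),
      (inc u \subset X) && (c \in clashes Z u v),
      (inc v \subset X) && (c \in clashes Z v u) |
      [&& inc u \subset X, deg u == deg v & c \in clash Z u v]].
Proof.
move=> XE uv eX Z gZ ngX; set e := [set u; v] in eX *.
case: (boolP (c e \in _)) => //= ci.
have [/proper_onP pZ dZ] := goodP _ _ gZ.
have pe A : A \in X -> A != e -> A :&: e != set0 -> c A != c e.
  move=> AX Ae /set0Pn[x /setIP[xA xe]]; apply: contra ci => /eqP <-.
  apply: imset_f; rewrite in_setD1 Ae in_setU !mem_inc (subsetP XE) //=.
  by move: xe; rewrite !inE => /orP[/eqP<-|/eqP<-]; rewrite xA ?orbT.
have pX : proper_on X c.
  apply/proper_onP => A B AX BX AB AI.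
  have [Ee|Ae] := eqVneq A e.
    by rewrite Ee eq_sym pe // -Ee; [rewrite eq_sym | rewrite setIC].
  have [Be|Be] := eqVneq B e; first by rewrite Be pe // -Be.
  by apply: pZ => //; rewrite in_setD1 ?Ae ?Be.
have main x y : x != y -> inc x \subset X -> inc y \subset X ->
    c @: inc x = c @: inc y -> x \in e ->
  [|| (inc u \subset X) && (c \in clashes Z u v),
      (inc v \subset X) && (c \in clashes Z v u) |
      [&& inc u \subset X, deg u == deg v & c \in clash Z u v]].
  move=> xy xX yX cxy xe.
  have ix := proper_on_inj pX xX; have iy := proper_on_inj pX yX.
  have dxy : deg x = deg y.
    by rewrite -!card_inc -(card_in_imset ix) -(card_in_imset iy) cxy.
  have cl : c \in clash Z x y by rewrite inE gZ (introT imset_injP ix) cxy eqxx.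
  have cl' : c \in clash Z y x by rewrite inE gZ (introT imset_injP iy) cxy eqxx.
  have yx : y != x by rewrite eq_sym.
  case/set2P: xe => [xu|xv].
    subst x; rewrite xX; have [yv|yv] := eqVneq y v.
      by subst y; rewrite dxy eqxx cl !orbT.
    rewrite (_ : c \in clashes Z u v) //.
    by apply/bigcupP; exists y => //; rewrite yx yv dxy eqxx.
  subst x; rewrite xX; have [yu|yu] := eqVneq y u.
    by subst y; rewrite yX dxy eqxx cl' !orbT.
  rewrite (_ : c \in clashes Z v u) ?orbT //.
  by apply/bigcupP; exists y => //; rewrite yx yu dxy eqxx.
have [x [y [xy xX yX cxy]]] : exists x y,
    [/\ x != y, inc x \subset X, inc y \subset X & c @: inc x = c @: inc y].
  move: ngX; rewrite /good pX /= => /forallPn[x /forallPn[y]].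
  by rewrite negb_imply negbK => /andP[/and3P[xy xX yX] /eqP E]; exists x, y.
have [xe|xe] := boolP (x \in e); first exact: main xy xX yX cxy xe.
have [ye|ye] := boolP (y \in e); first by apply: main yX xX (esym cxy) ye; rewrite eq_sym.
have sZ z : z \notin e -> inc z \subset X -> inc z \subset Z.
  move=> ze zX; apply/subsetP => A Az; rewrite in_setD1 (subsetP zX) // andbT.
  by apply: contraNneq ze => Ae; move: Az; rewrite Ae mem_inc => /andP[].
by have := dZ x y xy (sZ _ xe xX) (sZ _ ye yX); rewrite cxy eqxx.
Qed.

Lemma card_improper u v Z : adj u v -> [set u; v] \notin Z ->
  #|[set c : {ffun _ -> 'I_M} | good Z c & c [set u; v] \in c @: ((inc u :|: inc v) :\ [set u; v])]| * M
    <= ((deg u).-1 + (deg v).-1) * num_good Z.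
Proof.
move=> uv eZ; set e := [set u; v] in eZ *.
have au (c : {ffun _ -> 'I_M}) a A : A != e -> upd c e a A = c A by rewrite ffunE => /negbTE->.
apply: (@count_coord _ M (@good G M Z) e (fun c => c @: ((inc u :|: inc v) :\ e))).
- by move=> c a; apply: good_agree => A AZ; rewrite au //; apply: contraNneq eZ => <-.
- by move=> c a; apply: eq_in_imset => A; rewrite in_setD1 => /andP[Ae _]; rewrite au.
- move=> c _; apply: leq_trans (leq_imset_card _ _) _; rewrite setDUl.
  apply: leq_trans (leq_card_setU _ _) _; rewrite -!card_inc.
  rewrite (cardsD1 e (inc u)) (cardsD1 e (inc v)).
  by rewrite inc_pairl // inc_pairr.
Qed.

Hypothesis no_K2 : forall u v, adj u v -> (1 < deg u) || (1 < deg v).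

Lemma growth_edges : growth M b (edges G).
Proof.
move=> X; have [n] := ubnP #|X|; elim: n X => // n IHn X nX e XE eX.
have gr : growth M b (X :\ e).
  move=> Y f YX fY; apply: IHn => //.
    have : #|Y| <= #|X :\ e| by apply: subset_leq_card.
    by move: nX; rewrite (cardsD1 e X) eX; lia.
  by apply: subset_trans YX (subset_trans (subD1set _ _) XE).
have /edgesP[u [v [uv ee]]] := subsetP XE _ eX; subst e.
set Z := X :\ _ in gr *; set N := num_good Z; set N' := num_good X.
have eZ : [set u; v] \notin Z by rewrite !inE eqxx.
pose bad := [set c : {ffun _ -> 'I_M} | good Z c & ~~ good X c].
have hN : N = #|bad| + N'.
  rewrite /N /num_good -(cardsID [set c | good X c]) addnC; congr (_ + _).
    by apply: eq_card => c; rewrite !inE andbC.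
  apply: eq_card => c; rewrite !inE; case: (boolP (good X c)); rewrite ?andbF ?andbT //.
  exact: good_sub (subD1set _ _).
pose Iu := if inc u \subset X then clashes Z u v else set0.
pose Iv := if inc v \subset X then clashes Z v u else set0.
pose Ie := if (inc u \subset X) && (deg u == deg v) then clash Z u v else set0.
pose Ip := [set c : {ffun _ -> 'I_M} | good Z c & c [set u; v] \in c @: ((inc u :|: inc v) :\ [set u; v])].
have cover : bad \subset (Ip :|: Iu) :|: (Iv :|: Ie).
  apply/subsetP => c; rewrite inE => /andP[gZ ngX].
  have := bad_cover XE uv eX gZ ngX; rewrite !in_setU [c \in Ip]inE gZ /=.
  case/or4P => [->//|/andP[h1 h2]|/andP[h1 h2]|/and3P[h1 h2 h3]].
  - by rewrite /Iu h1 h2 orbT.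
  - by rewrite /Iv h1 h2 !orbT.
  - by rewrite /Ie h1 h2 h3 !orbT.
have hbad : #|bad| <= #|Ip| + #|Iu| + (#|Iv| + #|Ie|).
  apply: leq_trans (subset_leq_card cover) _.
  by apply: leq_trans (leq_card_setU _ _) _; apply: leq_add; apply: leq_card_setU.
have hp : #|Ip| * M <= ((deg u).-1 + (deg v).-1) * N by apply: card_improper.
have hu : 2 * (M * #|Iu|) <= (if deg u == 1 then 2 * k else k.+1) * N.
  by rewrite /Iu; case: ifP => uX; [apply: card_clashes | rewrite cards0 !muln0].
have hv : 2 * (M * #|Iv|) <= (if deg v == 1 then 2 * k else k.+1) * N.
  rewrite /Iv; case: ifP => vX; last by rewrite cards0 !muln0.
  by rewrite /N /Z setUC; apply: card_clashes; rewrite // 1?adj_sym // setUC.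
(* Equal degrees at the ends of an edge are at least 2, by [no_K2]. *)
have he : M * #|Ie| <= 5 * N.
  rewrite /Ie; case: ifP => [/andP[uX /eqP duv]|_]; last by rewrite cards0 !muln0.
  by apply: card_clash_ends => //; have := no_K2 uv; rewrite duv orbb.
have k0 : 0 < k by apply: leq_trans (deg_le_bound u); apply/card_gt0P; exists v; rewrite inE.
(* Two ends of degree at least 2 give at most [6 * k + 8], and one end of degree 1 at most
   [5 * k + 9], which is no larger as [k] is positive. The number of colours fits exactly:
   [2 * M - (6 * k + 8) = 4 * k = 2 * b]. *)
have tot : 2 * (M * #|bad|) <= (6 * k + 8) * N.
  apply: (@leq_trans ((2 * ((deg u).-1 + (deg v).-1) + (if deg u == 1 then 2 * k else k.+1)
     + (if deg v == 1 then 2 * k else k.+1) + 10) * N)).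
    exact: weighted_union_bound hbad hp hu hv he.
  rewrite leq_mul2r; apply/orP; right.
  have := no_K2 uv; have := deg_le_bound u; have := deg_le_bound v.
  have : 0 < deg u by apply/card_gt0P; exists v; rewrite inE.
  have : 0 < deg v by apply/card_gt0P; exists u; rewrite inE adj_sym.
  by case: eqP; case: eqP; lia.
rewrite -/b -(@leq_pmul2l 2) //.
have : 2 * (M * N) = 2 * (M * #|bad|) + 2 * (M * N') by rewrite [in LHS]hN mulnDr mulnDr.
rewrite /b {1}/M; move: tot; rewrite !mulnDl; lia.
Qed.

End Growth.

(** * From growth to the bound on the chromatic index *)

Lemma vertex_deg_bounds (G : sgraph) (x : G) : min_deg G <= deg x <= max_deg G.
Proof.
rewrite /max_deg leq_bigmax andbT /min_deg.
have := mem_index_enum x; elim: (index_enum _) => // y r IHr.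
rewrite inE big_cons geq_min => /orP[/eqP<-|/IHr->]; first by rewrite leqnn.
by rewrite orbT.
Qed.

Lemma isolated_edge_component (G : sgraph) (u v : G) :
  adj u v -> deg u = 1 -> deg v = 1 ->
  [set u; v] = [set y | connect (@adj G) u y].
Proof.
have nbr (a c d : G) : deg a = 1 -> adj a c -> adj a d -> d = c.
  move=> /eqP/cards1P[z zE] ac ad.
  have /set1P-> : d \in [set z] by rewrite -zE inE.
  by have /set1P-> : c \in [set z] by rewrite -zE inE.
move=> uv du dv; apply/setP => w; rewrite [RHS]inE; apply/idP/idP.
  by rewrite !inE => /orP[/eqP->|/eqP->]; [apply: connect0 | apply: connect1].
have clo : closed (@adj G) (mem [set u; v]).
  apply: intro_closed; first by apply: sym_connect_sym => a b; rewrite adj_sym.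
  move=> a b ab; rewrite !inE => /orP[/eqP Ea|/eqP Ea]; subst a.
    by rewrite (nbr u v b du uv ab) eqxx orbT.
  by rewrite (nbr v u b dv _ ab) ?eqxx // adj_sym.
by move=> /(closed_connect clo) <-; rewrite !inE eqxx.
Qed.

Lemma no_isolated_edge_deg (G : sgraph) (u v : G) :
  no_isolated_edge G -> adj u v -> (1 < deg u) || (1 < deg v).
Proof.
move=> h uv; have du : 0 < deg u by apply/card_gt0P; exists v; rewrite inE.
have dv : 0 < deg v by apply/card_gt0P; exists u; rewrite inE adj_sym.
apply: contraT; rewrite negb_or => /andP[du1 dv1].
have E : [set u; v] = [set y | connect (@adj G) u y].
  by apply: isolated_edge_component => //; lia.
have /(forall_inP h)/existsPn/(_ u)/existsPn/(_ v) : [set u; v] \in components G.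
  by rewrite E imset_f.
by rewrite adj_neq // uv eqxx.
Qed.

Lemma vd_colorable_5k4 (G : sgraph) k :
  at_most_one_isolated_vertex G -> no_isolated_edge G -> counting_bound G k ->
  vd_colorable G (5 * k + 4).
Proof.
move=> h0 h1 hk; rewrite /vd_colorable addn4 /= -addn4.
have hn (x : G) : num_deg G (deg x) <= 'C(k, deg x).
  have /andP[mx xM] := vertex_deg_bounds x.
  by have /forallP/(_ (Ordinal (xM : deg x < (max_deg G).+1)))/implyP := hk; apply.
have gr := growth_edges hn (fun u v => no_isolated_edge_deg h1).
(* Only isolated vertices have their star inside the empty set, and there is at most one of them, so
   a constant colouring is good. *)
have good0 : @num_good G (5 * k + 4) set0 > 0.
  apply/card_gt0P; exists [ffun=> cast_ord (esym (addnS _ 3)) ord0].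
  rewrite inE; apply/goodP; split; first by apply/proper_onP => A B; rewrite inE.
  have iso (x : G) : inc x \subset set0 -> x \in isolated G.
    by rewrite subset0 => /eqP E; rewrite inE -card_inc E cards0.
  move=> x y xy /iso ix /iso iy.
  have : 1 < #|isolated G| by apply/card_gt1P; exists x, y.
  by rewrite ltnNge (h0 : #|isolated G| <= 1).
have /card_gt0P[c] : 0 < @num_good G (5 * k + 4) (edges G).
  have := growth_exp gr (subxx _); rewrite setDv => h.
  (* An edgeless graph is treated apart: there [k] may be 0, and the growth factor [2 * k] with
     it. *)
  have [E0|/set0Pn[A /edgesP[u [v [uv _]]]]] := eqVneq (edges G) set0; first by rewrite E0.
  have k0 : 0 < k by apply: leq_trans (deg_le_bound hn u); apply/card_gt0P; exists v; rewrite inE.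
  apply: contraTT h; rewrite -!leqNgt leqn0 => /eqP ->.
  by rewrite muln0 -ltnNge muln_gt0 expn_gt0 good0 muln_gt0 k0.
rewrite inE => /goodP[pc dc]; apply/existsP; exists c; apply/andP; split; first exact: pc.
have palE x : palette c x = c @: inc x.
  by apply/setP => a; apply/imsetP/imsetP => -[A AP ->]; exists A => //; move: AP; rewrite mem_inc !inE.
apply/forallP => x; apply/forallP => y; apply/implyP => xy; rewrite !palE.
by apply: dc => //; apply/subsetP => A; rewrite mem_inc => /andP[].
Qed.

Theorem theorem1p2 (G : sgraph)
    (h0 : at_most_one_isolated_vertex G) (h1 : no_isolated_edge G) :
  ((chi_vd h0 h1)%:Z <= Num.floor (5.5%Q * (kG h0)%:R + 6.5%Q :> rat))%R.
Proof.
rewrite /chi_vd; case: ex_minnP => m _ hm; rewrite /kG; case: ex_minnP => k hk _.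
have mk : m <= 5 * k + 4 by apply: hm; apply: vd_colorable_5k4.
rewrite Num.Theory.floor_ge_int.
have : (m%:R <= (5 * k + 4)%:R :> rat)%R by rewrite Num.Theory.ler_nat.
have : (0 <= k%:R :> rat)%R by rewrite Num.Theory.ler0n.
have -> : 5.5%Q = (11%:R / 2%:R)%R by apply/eqP.
have -> : 6.5%Q = (13%:R / 2%:R)%R by apply/eqP.
rewrite -pmulrn GRing.natrD GRing.natrM.
lra.
Qed.
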